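(* Let $\mathscr{D}$ be a collection of open discs, set $K=\overline{\mathbb{D}}\setminus\bigcup_{D\in\mathscr{D}}D$, and suppose that $0\in K$. Let $m\in\mathbb{N}$, and suppose that $\mathscr{D}$ satisfies the Browder condition of order $m$ at $0$. Then there exists a collection $\widetilde{\mathscr{D}}$ of open discs such that the following properties hold: \begin{enumerate} \item[(a)] $0\in\overline{\mathbb{D}}\setminus\bigcup_{\widetilde{D}\in\widetilde{\mathscr{D}}}\widetilde{D}\subseteq\sqrt{K}$; \item[(b)] $\widetilde{\mathscr{D}}$ satisfies the Browder condition of order $2m$ at $0$; \item[(c)] the $2m$th order Browder sum for $\widetilde{\mathscr{D}}$ at $0$ is strictly less than the $m$th order Browder sum for $\mathscr{D}$ at $0$ (provided $\mathscr{D}$ is nonempty). \end{enumerate}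
   Context: $\mathbb{N}=\{1,2,\dots\}$; $\mathbb{D}$ is the open unit disc in $\mathbb{C}$. For $E\subseteq\mathbb{C}$, $\sqrt{E}=\{z\in\mathbb{C}:z^2\in E\}$. For an open disc $D$, $r(D)$ is its radius, and for $a\in\mathbb{C}$, $s_a(D)=\inf\{|z-a|:z\in\partial D\}$. For a collection $\mathscr{D}$ of open discs, $m\in\mathbb{N}\cup\{0\}$ and $a\in\overline{\mathbb{D}}\setminus\bigcup_{D\in\mathscr{D}}D$, the $m$th order Browder sum for $\mathscr{D}$ at $a$ is $$\sum_{D\in\mathscr{D}\cup\{\mathbb{D}\}}\frac{r(D)}{s_a(D)^{m+1}},$$ and $\mathscr{D}$ satisfies the Browder condition of order $m$ at $a$ if this sum is finite. By standing convention, every disc in each collection of discs considered ($\mathscr{D}$ and $\widetilde{\mathscr{D}}$) intersects $\mathbb{D}$. *)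

(* Defs.v *)
From mathcomp Require Import all_boot all_order all_algebra.
From mathcomp Require Import all_classical all_reals all_analysis.
From mathcomp Require Import complex.

Set Implicit Arguments.
Unset Strict Implicit.
Unset Printing Implicit Defensive.

Import Order.TTheory GRing.Theory Num.Theory.
Import numFieldNormedType.Exports.
Import Normc.

Local Open Scope classical_set_scope.
Local Open Scope ring_scope.

(* An open disc of the complex plane is a pair (centre, radius) with positive
   radius.  As a subset of the plane such a disc determines its centre and its
   radius, so a set of such pairs is the same thing as a collection of open
   discs. *)
Definition disc (R : realType) := {p : R[i] * R | 0 < p.2}.

Definition disc_center (R : realType) (D : disc R) : R[i] := (val D).1.

Definition disc_radius (R : realType) (D : disc R) : R := (val D).2.

Definition points (R : realType) (D : disc R) : set R[i] :=
  [set z | normc (z - disc_center D) < disc_radius D].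

Definition unit_disc (R : realType) : disc R :=
  exist (fun p : R[i] * R => 0 < p.2) (0, 1) ltr01.

(* [R[i]^o] is [R[i]] with the topology of its norm, i.e. the usual topology of
   the plane; [R[i]] itself has no canonical topology. *)
Definition boundary (R : realType) (A : set R[i]^o) : set R[i] :=
  closure A `\` interior A.

(* The set of distances is nonempty and bounded below by 0, so the real-valued
   infimum is the genuine one. *)
Definition boundary_dist (R : realType) (a : R[i]) (D : disc R) : R :=
  inf [set normc (z - a) | z in boundary (points D)].

Definition meets_unit_disc (R : realType) (DD : set (disc R)) : Prop :=
  forall D, DD D -> points D `&` points (unit_disc R) !=set0.

Definition residual_set (R : realType) (DD : set (disc R)) : set R[i] :=
  closure (points (unit_disc R) : set R[i]^o) `\` \bigcup_(D in DD) points D.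

Definition sqrt_set (R : realType) (E : set R[i]) : set R[i] :=
  [set z | E (z ^+ 2)].

(* The division is that of the extended reals, where the inverse of 0 is +oo:
   the sum is +oo as soon as [a] lies on the boundary of one of the discs. *)
Definition browder_sum (R : realType) (DD : set (disc R)) (m : nat) (a : R[i])
    : \bar R :=
  \esum_(D in DD `|` [set unit_disc R])
    ((disc_radius D)%:E / (boundary_dist a D ^+ m.+1)%:E)%E.

Definition browder_condition (R : realType) (DD : set (disc R)) (m : nat)
    (a : R[i]) : Prop :=
  (browder_sum DD m a < +oo)%E.

(* Main.v *)
Require Import Defs.
From mathcomp Require Import all_boot all_order all_algebra.
From mathcomp Require Import all_classical all_reals all_analysis.
From mathcomp Require Import complex ring lra.

Set Implicit Arguments.
Unset Strict Implicit.
Unset Printing Implicit Defensive.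

Import Order.TTheory GRing.Theory Num.Theory.
Import numFieldNormedType.Exports.
Import Normc.

Local Open Scope classical_set_scope.
Local Open Scope ring_scope.

(** Let [D] be one of the discs, with centre [c] and radius [r].  Since [0] is
    not in [D], [r <= |c|], and finiteness of the Browder sum forbids equality,
    since a disc whose boundary passes through [0] contributes [+oo].  The
    preimage of [D] under squaring is then the interior of a Cassini oval with
    two lobes, symmetric about [0] and lying around the square roots of [c].
    Put [p = sqrt (|c| + r)] and [q = sqrt (|c| - r)]: these are the largest and
    the smallest modulus on the closure of each lobe, and both are attained on
    the axis through the square roots of [c].

    The disc whose diameter is the axis of a lobe contains that lobe
    ([oval_in_lobes]).  It has radius [(p - q) / 2] and distance [q] to [0], so
    the two discs obtained from [D] together contribute to the sum of order
    [2m]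
      [(p - q) / q ^ (2m+1)],
    whereas [D] contributes to the sum of order [m]
      [r / (|c| - r) ^ (m+1) = (p ^ 2 - q ^ 2) / 2 / q ^ (2m+2)
                             = (p - q) / q ^ (2m+1) * ((p + q) / (2 q))],
    which is strictly larger because [p > q] ([browder_term_lobe_discs]).

    The new collection consists of these two discs for every [D].  As every
    preimage of a removed disc is covered, its residual set squares into the
    old one.  The term of the unit disc is [1] on both sides, and a convergent
    sum of nonnegative terms strictly decreases when all of its terms do
    ([esum_lt]).  Whether different discs yield different discs is immaterial:
    a sum over a set of discs counts a repeated disc only once, so repetitions
    could only make it smaller ([esum_image_le]). *)

(** * The modulus *)

(* keeps [normc 0] and [normc 1] from unfolding to square roots *)
Local Arguments normc : simpl never.

Lemma normc_ge0 (R : realType) (z : R[i]) : 0 <= normc z.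
Proof. by case: z => x y; rewrite /normc sqrtr_ge0. Qed.

Lemma sqr_normcE (R : realType) (x y : R) :
  normc (Complex x y) ^+ 2 = x ^+ 2 + y ^+ 2.
Proof. by rewrite /normc sqr_sqrtr ?addr_ge0 ?sqr_ge0. Qed.

Lemma normc_real (R : realType) (x : R) : normc (x%:C)%C = `|x|.
Proof. by rewrite /normc /= expr0n /= addr0 sqrtr_sqr. Qed.

Lemma normc_opp (R : realType) (z : R[i]) : normc (- z) = normc z.
Proof. exact: normcN. Qed.

Lemma normc_distC (R : realType) (z w : R[i]) : normc (z - w) = normc (w - z).
Proof. by rewrite -normc_opp opprB. Qed.

Lemma normc_triangle (R : realType) (z w : R[i]) :
  normc (z + w) <= normc z + normc w.
Proof. exact: le_normcD. Qed.

Lemma normc_sqr (R : realType) (z : R[i]) : normc (z ^+ 2) = normc z ^+ 2.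
Proof. by rewrite !expr2 normcM. Qed.

Lemma normc_le_dist (R : realType) (z w : R[i]) :
  normc z - normc w <= normc (z - w).
Proof. by rewrite lerBlDr -{1}(subrK w z) normc_triangle. Qed.

(** * Topology of discs and distance to the origin *)

Lemma points_ball (R : realType) (D : disc R) :
  points D = ball (disc_center D : R[i]^o) ((disc_radius D)%:C)%C.
Proof.
by apply/seteqP; split=> z; rewrite /points /ball /= /ball_ /= ltcR normc_distC.
Qed.

Lemma interior_points (R : realType) (D : disc R) :
  interior (points D : set R[i]^o) = points D.
Proof. by apply/interior_id; rewrite points_ball; exact: ball_open. Qed.

Lemma closure_points (R : realType) (D : disc R) :
  closure (points D : set R[i]^o) =
  [set z | normc (z - disc_center D) <= disc_radius D].
Proof.
have r0 : 0 < disc_radius D := valP D.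
apply/seteqP; split=> z /= zD.
  rewrite leNgt; apply/negP => rz.
  pose e := normc (z - disc_center D) - disc_radius D.
  have e0 : 0 < (e%:C)%C :> R[i] by rewrite ltcR subr_gt0.
  have [w [wD]] := zD _ (nbhsx_ballx (z : R[i]^o) _ e0).
  rewrite /ball /= /ball_ /= ltcR /e => zw.
  have := normc_triangle (z - w : R[i]) (w - disc_center D).
  rewrite addrA subrK; move: wD; rewrite /points /=; lra.
move=> B /nbhs_ballP[/= e e0 eB].
have [x ex x0] : exists2 x : R, e = (x%:C)%C & 0 < x.
  case: e e0 {eB} => a b; rewrite ltcE /= => /andP[/eqP -> a0].
  by exists a.
(* a point at distance at most [r] from the centre is moved towards the centre
   by the factor [1 - t], where [t] is small enough to stay within [x] of it *)
pose rho := normc (z - disc_center D).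
pose t := x / (x + rho) / 2.
have rho0 : 0 <= rho := normc_ge0 _.
have t0 : 0 < t by rewrite !divr_gt0 // ltr_wpDr.
have tx : t * (x + rho) = x / 2 by rewrite /t; field; lra.
have t1 : t < 1 by nra.
exists (z - (t%:C)%C * (z - disc_center D)); split.
  rewrite /points /=.
  have -> : z - (t%:C)%C * (z - disc_center D) - disc_center D =
    ((1 - t)%:C)%C * (z - disc_center D).
    by rewrite rmorphB rmorph1; ring.
  rewrite normcM normc_real ger0_norm; last lra.
  rewrite -/rho in zD *; nra.
apply: eB; rewrite /ball /= /ball_ /= ex ltcR opprB addrC subrK normcM.
rewrite normc_real ger0_norm ?ltW// -/rho; nra.
Qed.

Lemma points_unit_disc (R : realType) :
  points (unit_disc R) = [set z | normc z < 1].
Proof. by apply/seteqP; split=> z; rewrite /points /= subr0. Qed.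

Lemma closure_unit_disc (R : realType) :
  closure (points (unit_disc R) : set R[i]^o) = [set z | normc z <= 1].
Proof. by rewrite closure_points; apply/seteqP; split=> z; rewrite /= subr0. Qed.

Lemma boundary_points (R : realType) (D : disc R) :
  boundary (points D) =
  [set z | normc (z - disc_center D) = disc_radius D].
Proof.
rewrite /boundary closure_points interior_points /points.
apply/seteqP; split=> z /=.
  by case=> zr /negP; rewrite -leNgt => rz; apply/le_anti/andP.
by move=> ->; split=> //; rewrite ltxx.
Qed.

(** By the triangle inequality no boundary point is closer to [0] than
    [| |c| - r |]; the boundary point on the ray from [c] through [0] attains
    this value, and any direction will do when [c] is [0]. *)
Lemma boundary_dist0 (R : realType) (D : disc R) :
  boundary_dist 0 D = `|normc (disc_center D) - disc_radius D|.
Proof.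
have r0 : 0 < disc_radius D := valP D.
set c := disc_center D; set r := disc_radius D.
have [u [u1 cu]] : exists u : R[i], normc u = 1 /\ c = ((normc c)%:C)%C * u.
  have [c0|c0] := eqVneq (normc c) 0.
    by exists 1; rewrite normc1 c0 mul0r (eq0_normc c0).
  have C0 : ((normc c)%:C)%C != 0 :> R[i] by rewrite eq_complex /= negb_and c0.
  exists (c / ((normc c)%:C)%C); split; last by rewrite mulrC divfK.
  by rewrite normcM normcV normc_real ger0_norm ?normc_ge0// divff.
have lb : lbound [set normc (z - 0) | z in boundary (points D)]
    `|normc c - r|.
  move=> _ [z + <-]; rewrite boundary_points subr0 => /= zr.
  rewrite -/c -/r in zr.
  have := normc_le_dist c z; have := normc_triangle z (- c).
  rewrite normc_opp (normc_distC c z) zr ler_norml; lra.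
apply/le_anti/andP; split; last first.
  apply: lb_le_inf => //.
  exists (normc (c - (r%:C)%C * u - 0)), (c - (r%:C)%C * u) => //.
  rewrite boundary_points /= addrAC subrr add0r normc_opp normcM u1 mulr1.
  by rewrite normc_real ger0_norm ?ltW.
apply: ge_inf; first by exists `|normc c - r|.
exists (c - (r%:C)%C * u).
  rewrite boundary_points /= addrAC subrr add0r normc_opp normcM u1 mulr1.
  by rewrite normc_real ger0_norm ?ltW.
by rewrite subr0 {1}cu -mulrBl -rmorphB normcM u1 mulr1 normc_real.
Qed.

(** * Covering a Cassini oval by two discs *)

(** With [N = x^2 + y^2] the hypothesis expands to
    [(N + p^2) (N + q^2) < 2 (p^2 + q^2) x^2].  Hence
    [(N + p q)^2 = (N + p^2) (N + q^2) - (p - q)^2 N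
                 < 2 (p^2 + q^2) x^2 - (p - q)^2 x^2 = (p + q)^2 x^2]. *)
Lemma oval_in_lobes_real (R : realType) (x y p q : R) :
  0 <= q -> q < p ->
  (x ^+ 2 - y ^+ 2 - (p ^+ 2 + q ^+ 2) / 2) ^+ 2 + (2 * x * y) ^+ 2
    < ((p ^+ 2 - q ^+ 2) / 2) ^+ 2 ->
  x ^+ 2 + y ^+ 2 + p * q < (p + q) * `|x|.
Proof.
move=> q0 qp oval.
have pq0 : 0 <= p * q by rewrite mulr_ge0 // ltW // (le_lt_trans q0).
rewrite -ltr_sqr ?nnegrE; [|nra|by rewrite mulr_ge0 //; lra].
rewrite exprMn real_normK ?num_real //.
(* the slack between [N] and [x^2] in the last inequality *)
have := sqr_ge0 ((p - q) * y).
nra.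
Qed.

(** The disc with diameter [[q, p]] on the real axis is
    [x^2 + y^2 + p q < (p + q) x], and its mirror image has [- x] in place of
    [x]; so the real inequality puts [z] in the one on its own side of the
    imaginary axis. *)
Lemma oval_in_lobes1 (R : realType) (z : R[i]) (p q : R) :
  0 <= q -> q < p ->
  normc (z ^+ 2 - (((p ^+ 2 + q ^+ 2) / 2)%:C)%C) < (p ^+ 2 - q ^+ 2) / 2 ->
  normc (z - (((p + q) / 2)%:C)%C) < (p - q) / 2 \/
  normc (z + (((p + q) / 2)%:C)%C) < (p - q) / 2.
Proof.
case: z => x y q0 qp oval.
have h : x ^+ 2 + y ^+ 2 + p * q < (p + q) * `|x|.
  apply: (@oval_in_lobes_real _ x y) => //.
  have r0 : 0 <= (p ^+ 2 - q ^+ 2) / 2 by nra.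
  move: oval; rewrite -ltr_sqr ?nnegrE ?normc_ge0 //.
  rewrite (expr2 (Complex x y)); simpc; rewrite sqr_normcE -!expr2.
  by rewrite (_ : x * y + y * x = 2 * x * y) //; ring.
have [x0|x0] := leP 0 x; [left|right];
  rewrite -ltr_sqr ?nnegrE ?normc_ge0 //; try lra;
  simpc; rewrite sqr_normcE.
- by move: h; rewrite ger0_norm //; nra.
- by move: h; rewrite ltr0_norm //; nra.
Qed.

(** A rotation by [v] carries the case of a real centre to that of a centre in
    the direction [v ^+ 2]. *)
Lemma oval_in_lobes (R : realType) (v z : R[i]) (p q : R) :
  normc v = 1 -> 0 <= q -> q < p ->
  normc (z ^+ 2 - (((p ^+ 2 + q ^+ 2) / 2)%:C)%C * v ^+ 2)
    < (p ^+ 2 - q ^+ 2) / 2 ->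
  normc (z - (((p + q) / 2)%:C)%C * v) < (p - q) / 2 \/
  normc (z - (((p + q) / 2)%:C)%C * - v) < (p - q) / 2.
Proof.
move=> v1 q0 qp.
have v0 : v != 0 by apply: contra_eq_neq v1 => ->; rewrite normc0 eq_sym oner_eq0.
have [w ->] : exists w, z = w * v by exists (z / v); rewrite divfK.
rewrite exprMn mulrN opprK -!mulrBl -!mulrDl normcM normc_sqr.
rewrite (normcM (_ - _) v) (normcM (_ + _) v) v1 expr1n !mulr1.
exact: oval_in_lobes1.
Qed.

(** * The two discs attached to a disc *)

Section Lobes.
Context {R : realType}.
Implicit Types (D : disc R) (v z : R[i]) (m : nat).

Definition lobe_outer D : R :=
  Num.sqrt (normc (disc_center D) + disc_radius D).

Definition lobe_inner D : R :=
  Num.sqrt (normc (disc_center D) - disc_radius D).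

Lemma lobe_inner_ge0 D : 0 <= lobe_inner D.
Proof. exact: sqrtr_ge0. Qed.

Lemma lobe_inner_lt_outer D : lobe_inner D < lobe_outer D.
Proof.
have r0 : 0 < disc_radius D := valP D.
rewrite ltr_sqrt; first by lra.
by rewrite ltr_wpDl ?normc_ge0.
Qed.

Lemma lobe_radius_gt0 D : 0 < (lobe_outer D - lobe_inner D) / 2.
Proof. by have := lobe_inner_lt_outer D; lra. Qed.

(** For a unit vector [v], the disc with the segment from
    [lobe_inner D * v] to [lobe_outer D * v] as diameter.  The square root of a
    negative number being [0], its radius is positive for every [D]. *)
Definition lobe_disc v D : disc R :=
  exist (fun p : R[i] * R => 0 < p.2)
    ((((lobe_outer D + lobe_inner D) / 2)%:C)%C * v,
     (lobe_outer D - lobe_inner D) / 2)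
    (lobe_radius_gt0 D).

(** A unit vector whose square points to the centre of [D], unless that is [0],
    where no direction is distinguished. *)
Definition sqrt_direction D : R[i] :=
  if disc_center D == 0 then 1
  else sqrtc (disc_center D / ((normc (disc_center D))%:C)%C).

Lemma normc_sqrt_direction D : normc (sqrt_direction D) = 1.
Proof.
rewrite /sqrt_direction; case: eqVneq => [_|c0]; first exact: normc1.
apply/eqP; rewrite -sqrp_eq1 ?normc_ge0 // -normc_sqr sqr_sqrtc normcM normcV.
rewrite normc_real ger0_norm ?normc_ge0 // divff //.
by apply: contra_neq c0 => /eq0_normc.
Qed.

Lemma sqrt_directionK D :
  ((normc (disc_center D))%:C)%C * sqrt_direction D ^+ 2 = disc_center D.
Proof.
rewrite /sqrt_direction; case: eqVneq => [->|c0]; first by rewrite normc0 mul0r.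
rewrite sqr_sqrtc mulrC divfK // eq_complex /= negb_and.
by rewrite (contra_neq _ c0) // => /eq0_normc.
Qed.

Lemma sqr_lobe_radii D : disc_radius D <= normc (disc_center D) ->
  normc (disc_center D) = (lobe_outer D ^+ 2 + lobe_inner D ^+ 2) / 2 /\
  disc_radius D = (lobe_outer D ^+ 2 - lobe_inner D ^+ 2) / 2.
Proof.
have r0 : 0 < disc_radius D := valP D.
move=> rc; rewrite /lobe_outer /lobe_inner !sqr_sqrtr ?subr_ge0 //; last lra.
by split; lra.
Qed.

Lemma not_in_points0 D :
  ~ points D 0 -> disc_radius D <= normc (disc_center D).
Proof. by move/negP; rewrite sub0r normc_opp -leNgt. Qed.

(** The preimage of [D] under squaring is the oval of [oval_in_lobes], where
    [p] and [q] are recovered from the centre and the radius of [D]. *)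
Lemma sqrt_in_lobes D z : ~ points D 0 -> points D (z ^+ 2) ->
  points (lobe_disc (sqrt_direction D) D) z \/
  points (lobe_disc (- sqrt_direction D) D) z.
Proof.
move=> /not_in_points0 /sqr_lobe_radii [cE rE].
rewrite /points /= -{1}(sqrt_directionK D) cE rE.
apply: oval_in_lobes; rewrite ?normc_sqrt_direction ?lobe_inner_ge0 //.
exact: lobe_inner_lt_outer.
Qed.

Lemma points_lobe_disc_opp v D z :
  points (lobe_disc (- v) D) z <-> points (lobe_disc v D) (- z).
Proof.
rewrite /points /= /disc_center /disc_radius /=.
by rewrite -normc_opp opprB mulrN addrC.
Qed.

(** A square root of a point of [D] of modulus less than [1] also has modulus
    less than [1] and lies in one of the two discs; its opposite lies in the
    other one. *)
Lemma lobe_disc_meets D : ~ points D 0 ->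
  points D `&` points (unit_disc R) !=set0 ->
  points (lobe_disc (sqrt_direction D) D) `&` points (unit_disc R) !=set0 /\
  points (lobe_disc (- sqrt_direction D) D) `&` points (unit_disc R) !=set0.
Proof.
move=> D0 [w [Dw w1]].
have z1 : points (unit_disc R) (sqrtc w).
  move: w1; rewrite points_unit_disc /=.
  by rewrite -{1}[w]sqr_sqrtc normc_sqr expr_lt1 ?normc_ge0.
have Nz1 : points (unit_disc R) (- sqrtc w).
  by move: z1; rewrite points_unit_disc /= normc_opp.
rewrite -[w]sqr_sqrtc in Dw.
have [Lz|Lz] := sqrt_in_lobes D0 Dw; split.
- by exists (sqrtc w).
- by exists (- sqrtc w); split=> //; apply/points_lobe_disc_opp; rewrite opprK.
- by exists (- sqrtc w); split=> //; exact/points_lobe_disc_opp.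
- by exists (sqrtc w).
Qed.

Lemma normc_lobe_center v D : normc v = 1 ->
  normc (disc_center (lobe_disc v D)) = (lobe_outer D + lobe_inner D) / 2.
Proof.
move=> v1; rewrite /disc_center /= normcM v1 mulr1 normc_real ger0_norm //.
by have := lobe_inner_ge0 D; have := lobe_inner_lt_outer D; lra.
Qed.

Lemma lobe_disc_boundary_dist v D : normc v = 1 ->
  boundary_dist 0 (lobe_disc v D) = lobe_inner D.
Proof.
move=> v1; rewrite boundary_dist0 normc_lobe_center // /disc_radius /=.
by rewrite ger0_norm; have := lobe_inner_ge0 D; lra.
Qed.

Lemma not_in_lobe_disc0 v D : normc v = 1 -> ~ points (lobe_disc v D) 0.
Proof.
move=> v1; rewrite /points /= sub0r normc_opp normc_lobe_center //.
by rewrite /disc_radius /=; have := lobe_inner_ge0 D; lra.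
Qed.

Definition browder_term m D : \bar R :=
  ((disc_radius D)%:E / (boundary_dist 0 D ^+ m.+1)%:E)%E.

Lemma browder_term_ge0 m D : (0 <= browder_term m D)%E.
Proof.
rewrite /browder_term mule_ge0 ?inve_ge0 ?lee_fin ?exprn_ge0 //.
  exact: ltW (valP D).
by rewrite boundary_dist0.
Qed.

(** Finiteness of the term of [D] means that [q = lobe_inner D] is nonzero; the
    two terms on the left are then equal, and after cancelling
    [(p - q) / q ^ (2m+1)] what remains is [1 < (p + q) / (2 q)]. *)
Lemma browder_term_lobe_discs m D : ~ points D 0 ->
  (browder_term m D < +oo)%E ->
  (browder_term (2 * m) (lobe_disc (sqrt_direction D) D) +
   browder_term (2 * m) (lobe_disc (- sqrt_direction D)%R D)
   < browder_term m D)%E.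
Proof.
move=> /not_in_points0 rc; rewrite /browder_term.
rewrite !lobe_disc_boundary_dist ?normc_opp ?normc_sqrt_direction //.
have [cE rE] := sqr_lobe_radii rc.
have -> : boundary_dist 0 D = lobe_inner D ^+ 2.
  by rewrite boundary_dist0 cE rE ger0_norm; have := sqr_ge0 (lobe_inner D); lra.
have qp := lobe_inner_lt_outer D.
have r0 : 0 < disc_radius D := valP D.
have [q0|q0] := eqVneq (lobe_inner D) 0.
  by rewrite q0 expr0n expr0n /= inve0 gt0_muley ?lte_fin // ltxx.
have {}q0 : 0 < lobe_inner D by rewrite lt_def q0 lobe_inner_ge0.
move=> _; rewrite !inver !gt_eqF ?exprn_gt0 //.
rewrite -!EFinM -EFinD lte_fin /disc_radius /= -/(disc_radius D) rE.
set p := lobe_outer D in qp *; set q := lobe_inner D in q0 qp *.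
rewrite -exprM mulnS add2n (exprS q (2 * m).+1).
set t := q ^+ (2 * m).+1.
have t0 : 0 < t by rewrite exprn_gt0.
rewrite invfM mulrA -mulrDl ltr_pM2r ?invr_gt0 // ltr_pdivlMr //.
by nra.
Qed.

End Lobes.

(** * Sums of nonnegative families *)

Section Esum.
Context {R : realType}.
Local Open Scope ereal_scope.

Lemma subset_le_esum (T : choiceType) (A B : set T) (a : T -> \bar R) :
  A `<=` B -> (forall i, 0 <= a i) ->
  \esum_(i in A) a i <= \esum_(i in B) a i.
Proof.
move=> AB a0; rewrite (esumID A B) // (setIidr AB) leeDl // esum_ge0 //.
Qed.

Lemma esumU_le (T : choiceType) (A B : set T) (a : T -> \bar R) :
  (forall i, 0 <= a i) ->
  \esum_(i in A `|` B) a i <= \esum_(i in A) a i + \esum_(i in B) a i.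
Proof.
move=> a0; rewrite (esumID A) // setUK leeD2l // subset_le_esum //.
by move=> i [[]].
Qed.

Lemma esum_setU1 (T : choiceType) (A : set T) (t : T) (a : T -> \bar R) :
  ~ A t -> (forall i, 0 <= a i) ->
  \esum_(i in A `|` [set t]) a i = \esum_(i in A) a i + a t.
Proof.
move=> At a0; rewrite (esumID A) // setUK; congr (_ + _).
rewrite (_ : _ `&` _ = [set t]) ?esum_set1 //.
by apply/seteqP; split=> [i [[]]//|_ ->]; split=> //; right.
Qed.

(** Each point of the image is summed once, whereas its whole fibre contributes
    on the right: restrict the right-hand sum to the range of a section [g] of
    [e]. *)
Lemma esum_image_le (T T' : choiceType) (e : T -> T') (A : set T)
    (a : T' -> \bar R) :
  (forall i, 0 <= a i) -> \esum_(j in e @` A) a j <= \esum_(i in A) a (e i).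
Proof.
move=> a0; have [->|/set0P[x0 _]] := eqVneq A set0.
  by rewrite image_set0 !esum_set0.
pose g y := xget x0 [set x | A x /\ e x = y].
have gP y : (e @` A) y -> A (g y) /\ e (g y) = y.
  by move=> [x Ax exy]; rewrite /g; case: xgetP => [_ _ []//|/(_ x)[]].
rewrite (eq_esum (b := fun j => a (e (g j)))) => [|y /gP[_ ->]//].
rewrite -(esum_image _ g (fun i => a (e i))).
  by apply: subset_le_esum => // _ [y /gP[Ag _] <-].
move=> y z; rewrite !inE => /gP[_ eg] /gP[_ eg'] gyz.
by rewrite -eg -eg' gyz.
Qed.

(** One strict inequality, at some [x], is enough for strictness, because the
    rest of the smaller sum is finite and can be cancelled. *)
Lemma esum_lt (T : choiceType) (A : set T) (a b : T -> \bar R) :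
  A !=set0 -> (forall i, 0 <= a i) -> (forall i, A i -> a i < b i) ->
  \esum_(i in A) b i < +oo -> \esum_(i in A) a i < \esum_(i in A) b i.
Proof.
move=> [x Ax] a0 ab.
have b0 i : A i -> 0 <= b i by move=> /ab /ltW; exact: le_trans.
rewrite (esumID [set x] A a) // (esumID [set x] A b) //.
have -> : A `&` [set x] = [set x] by apply/setIidr => _ ->.
have le : \esum_(i in A `&` ~` [set x]) a i <= \esum_(i in A `&` ~` [set x]) b i.
  by apply: le_esum => i [/ab /ltW].
rewrite !esum_set1 ?b0 // => fin; apply: lte_leD => //; last exact: ab.
rewrite ge0_fin_numE ?esum_ge0 // (le_lt_trans le) // (le_lt_trans _ fin) //.
by rewrite leeDr ?b0.
Qed.

End Esum.

(** * Browder sums at the origin *)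

Lemma residual0 (R : realType) (DD : set (disc R)) :
  (forall D, DD D -> ~ points D 0) -> residual_set DD 0.
Proof.
move=> DD0; split; last by case=> D /DD0.
by rewrite closure_unit_disc /= normc0 ler01.
Qed.

(** The unit disc contains [0], so it is not in the collection and the union in
    the definition of the sum is disjoint. *)
Lemma browder_sumE (R : realType) (DD : set (disc R)) m :
  (forall D, DD D -> ~ points D 0) ->
  browder_sum DD m 0 =
  (\esum_(D in DD) browder_term m D + browder_term m (unit_disc R))%E.
Proof.
move=> DD0; rewrite /browder_sum esum_setU1 //; last exact: browder_term_ge0.
by move=> /DD0; apply; rewrite points_unit_disc /= normc0 ltr01.
Qed.

Lemma browder_term_unit_disc (R : realType) m :
  browder_term m (unit_disc R) = 1%E.
Proof.
rewrite /browder_term boundary_dist0 /= /disc_center /disc_radius /=.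
by rewrite normc0 sub0r normrN1 expr1n inve1 mule1.
Qed.

Theorem theorem1p8 (R : realType) (DD : set (disc R))
    (DD_meets : meets_unit_disc DD)
    (K0 : residual_set DD 0)
    (m : nat) (m_gt0 : (0 < m)%N)
    (DD_browder : browder_condition DD m 0) :
  exists DD' : set (disc R),
    [/\ meets_unit_disc DD',
        residual_set DD' 0 /\ residual_set DD' `<=` sqrt_set (residual_set DD),
        browder_condition DD' (2 * m)%N 0
      & DD !=set0 -> (browder_sum DD' (2 * m)%N 0%R < browder_sum DD m 0%R)%E].
Proof.
have DD0 D : DD D -> ~ points D 0 by case: K0 => _ nD DDD D0; apply: nD; exists D.
pose lobe1 D : disc R := lobe_disc (sqrt_direction D) D.
pose lobe2 D : disc R := lobe_disc (- sqrt_direction D) D.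
pose DD' := lobe1 @` DD `|` lobe2 @` DD.
have DD'0 D : DD' D -> ~ points D 0.
  by case=> -[E _ <-]; apply: not_in_lobe_disc0;
    rewrite ?normc_opp normc_sqrt_direction.
have fin : (\esum_(D in DD) browder_term m D < +oo)%E.
  move: DD_browder; rewrite /browder_condition browder_sumE //.
  by apply: le_lt_trans; rewrite leeDl ?browder_term_ge0.
have term_lt D : DD D ->
    (browder_term (2 * m) (lobe1 D) + browder_term (2 * m) (lobe2 D)
     < browder_term m D)%E.
  move=> DDD; apply: browder_term_lobe_discs; first exact: DD0.
  apply: le_lt_trans fin; rewrite -[leLHS](@esum_set1 _ _ D (browder_term m)).
    by apply: subset_le_esum; [move=> _ ->|exact: browder_term_ge0].
  exact: browder_term_ge0.
have term0 k D := @browder_term_ge0 R k D.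
have sum_le : (\esum_(D in DD') browder_term (2 * m) D <=
    \esum_(D in DD) (browder_term (2 * m) (lobe1 D) +
                     browder_term (2 * m) (lobe2 D)))%E.
  apply: (le_trans (esumU_le _ _ (term0 _))).
  by rewrite esumD //; apply: leeD; exact: esum_image_le.
exists DD'; split.
- by move=> D [] [E EDD <-]; have [] := lobe_disc_meets (DD0 _ EDD) (DD_meets _ EDD).
- split; first exact: residual0.
  move=> z [zU zDD']; split.
    move: zU; rewrite !closure_unit_disc /= normc_sqr.
    by apply: exprn_ile1; exact: normc_ge0.
  case=> D DDD /(sqrt_in_lobes (DD0 _ DDD)) [] zL; apply: zDD'.
    by exists (lobe1 D) => //; left; exists D.
  by exists (lobe2 D) => //; right; exists D.
- rewrite /browder_condition browder_sumE // browder_term_unit_disc.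
  apply: lte_add_pinfty; last exact: ltry.
  apply: (le_lt_trans sum_le).
  by apply: le_lt_trans fin; apply: le_esum => D /term_lt /ltW.
- move=> DDn; rewrite !browder_sumE // !browder_term_unit_disc lteD2rE //.
  apply: (le_lt_trans sum_le); apply: esum_lt => // D.
  exact: adde_ge0.
Qed.
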